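(* Under Assumptions 1–2, assume $r_\ell<\min\{m_\ell,n_\ell\}$ for all $\ell$. If the hyperparameters satisfy $0<\beta_1\le1$, $\tau\ge\frac{64}{3\beta_1\underline\delta}$, and $0<\eta\le\min\Big\{\frac1{4L},\sqrt{\frac{3\underline\delta\beta_1^2}{80L^2}},\sqrt{\frac{3\underline\delta}{80\tau^2L^2}},\sqrt{\frac{3\beta_1}{16\tau L^2}}\Big\}$, then GaLore using deterministic gradients and MSGD with momentum projection satisfies, for every integer $K\ge1$, $\frac1{K\tau}\sum_{t=0}^{K\tau-1}\|\nabla f(x^{(t)})\|_2^2\le\frac{16\Delta}{\underline\delta\eta K\tau}.$
   Context: Parameters $x=(\mathrm{vec}(X_1)^\top,\dots,\mathrm{vec}(X_{N_L})^\top)^\top\in\mathbb{R}^d$, $X_\ell\in\mathbb{R}^{m_\ell\times n_\ell}$; $\nabla_\ell$ is the gradient w.r.t. $X_\ell$. Assumption 1: $\inf f>-\infty$. Assumption 2: $\nabla f$ is $L$-Lipschitz in $\|\cdot\|_2$. $\Delta=f(x^{(0)})-\inf f$, $\delta_\ell=r_\ell/\min\{m_\ell,n_\ell\}$, $\underline\delta=\min_\ell\delta_\ell$. Algorithm (deterministic GaLore with MSGD and momentum projection): $M_\ell^{(-1)}=0$. For $t\ge0$ and each $\ell$: $G_\ell^{(t)}=\nabla_\ell f(x^{(t)})$. If $t\equiv0\pmod\tau$, take an SVD $G_\ell^{(t)}=U\Sigma V^\top$ (singular values nonincreasing), $P_\ell^{(t)}=U[:,:r_\ell]$, $Q_\ell^{(t)}=V[:,:r_\ell]$;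 otherwise $P_\ell^{(t)}=P_\ell^{(t-1)}$, $Q_\ell^{(t)}=Q_\ell^{(t-1)}$. If $m_\ell\le n_\ell$: $M_\ell^{(t)}=(1-\beta_1)(P_\ell^{(t)})^\top P_\ell^{(t-1)}M_\ell^{(t-1)}+\beta_1(P_\ell^{(t)})^\top G_\ell^{(t)}$, $X_\ell^{(t+1)}=X_\ell^{(t)}-\eta P_\ell^{(t)}M_\ell^{(t)}$. If $m_\ell>n_\ell$: $M_\ell^{(t)}=(1-\beta_1)M_\ell^{(t-1)}(Q_\ell^{(t-1)})^\top Q_\ell^{(t)}+\beta_1G_\ell^{(t)}Q_\ell^{(t)}$, $X_\ell^{(t+1)}=X_\ell^{(t)}-\eta M_\ell^{(t)}(Q_\ell^{(t)})^\top$. *)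

(* Defs.v *)
From HB Require Import structures.
From mathcomp Require Import all_boot all_order all_algebra.
From mathcomp Require Import all_classical all_reals all_analysis.
Set Implicit Arguments. Unset Strict Implicit. Unset Printing Implicit Defensive.
Import Order.TTheory GRing.Theory Num.Theory.
Import numFieldNormedType.Exports.
Local Open Scope ring_scope.

Section Params.
Variables (R : realType) (NL : nat) (m n : 'I_NL -> nat).

Definition params := forall l : 'I_NL, 'M[R]_(m l, n l).

Definition padd (x y : params) : params := fun l => x l + y l.
Definition psub (x y : params) : params := fun l => x l - y l.
Definition pscale (a : R) (x : params) : params := fun l => a *: x l.

Definition pinner (x y : params) : R :=
  \sum_(l < NL) \sum_(i < m l) \sum_(j < n l) x l i j * y l i j.
Definition pnormsq (x : params) : R := pinner x x.
Definition pnorm (x : params) : R := Num.sqrt (pnormsq x).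

Definition is_gradient (f : params -> R) (G : params -> params) : Prop :=
  forall x v : params,
    is_derive (0 : R) (1 : R) (fun h : R => f (padd x (pscale h v))) (pinner (G x) v).

Definition lipschitz_grad (G : params -> params) (L : R) : Prop :=
  forall x y, pnorm (psub (G x) (G y)) <= L * pnorm (psub x y).

(* delta_l = r_l / min(m_l, n_l), underline delta = min_l delta_l
   (identity 1 is harmless since every delta_l < 1 when r_l < min(m_l,n_l)) *)
Definition delta (r : 'I_NL -> nat) (l : 'I_NL) : R :=
  (r l)%:R / (minn (m l) (n l))%:R.
Definition delta_min (r : 'I_NL -> nat) : R :=
  \big[Num.min/1]_(l < NL) delta r l.
End Params.

Definition is_svd (R : realType) (p q : nat) (A : 'M[R]_(p, q))
    (U : 'M[R]_p) (S : 'M[R]_(p, q)) (V : 'M[R]_q) : Prop :=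
  [/\ U^T *m U = 1%:M, V^T *m V = 1%:M, A = U *m S *m V^T,
      (forall (i : 'I_p) (j : 'I_q), (i : nat) <> j -> S i j = 0) /\
      (forall (i : 'I_p) (j : 'I_q), (i : nat) = j -> 0 <= S i j) &
      (forall (i i' : 'I_p) (j j' : 'I_q), (i : nat) = j -> (i' : nat) = j' ->
          (i <= i')%N -> S i' j' <= S i j)].

Definition leading_cols (R : realType) (p k r : nat) (A : 'M[R]_(p, k)) (P : 'M[R]_(p, r)) : Prop :=
  forall (i : 'I_p) (j : 'I_r) (j' : 'I_k), (j' : nat) = j -> P i j = A i j'.

(* Main.v *)
Require Import Defs.
From HB Require Import structures.
From mathcomp Require Import all_boot all_order all_algebra.
From mathcomp Require Import all_classical all_reals all_analysis.
From mathcomp Require Import ring lra.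
Set Implicit Arguments. Unset Strict Implicit. Unset Printing Implicit Defensive.
Import Order.TTheory GRing.Theory Num.Theory.
Import numFieldNormedType.Exports.
Local Open Scope ring_scope.
Local Open Scope classical_set_scope.

(** Lifting the momentum back to full size (P M, resp. M Q^T) turns the algorithm
    into x' = x - eta m', m' = p' ((1 - b) m + b g'), where p is an orthogonal
    projection that is constant on each period of length tau; at the start of a
    period it captures a fraction delta of |g|^2, because the leading singular
    values are the largest ones.  Since m lies in the range of p,
    |g - m|^2 = N + E with N = |g - p g|^2 and E = |p g - m|^2.  Within a period
    N <= (1 - delta/2) |g|^2 and E' <= (1 - b) E, both up to the drift of the
    iterates; when the projection changes, E inherits one extra term N, whose
    total weight 1/(b tau) is small compared with delta.  Hence
    f + eta/(2 b) E decreases over each period by at least eta delta / 16 times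
    the sum of the |g|^2, and also pays for the initial error E_0 <= |g_0|^2. *)

(** * Quadratic estimates for a positive semidefinite form and its orthogonal projections *)

Section InnerProduct.
Variables (R : realFieldType) (V : lmodType R).

Definition inner_product (ip : V -> V -> R) : Prop :=
  [/\ (forall u v, ip u v = ip v u),
      (forall u v w, ip (u + v) w = ip u w + ip v w),
      (forall a u v, ip (a *: u) v = a * ip u v) &
      (forall v, 0 <= ip v v)].

Definition orthogonal_projection (ip : V -> V -> R) (p : V -> V) : Prop :=
  [/\ (forall u v, p (u + v) = p u + p v),
      (forall a u, p (a *: u) = a *: p u),
      (forall u, p (p u) = p u) &
      (forall u v, ip (p u) v = ip u (p v))].

Variable ip : V -> V -> R.
Hypothesis ip_inner : inner_product ip.
Local Notation nsq v := (ip v v).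

Lemma ipC u v : ip u v = ip v u. Proof. by case: ip_inner. Qed.
Lemma ipDl u v w : ip (u + v) w = ip u w + ip v w. Proof. by case: ip_inner. Qed.
Lemma ipZl a u v : ip (a *: u) v = a * ip u v. Proof. by case: ip_inner. Qed.
Lemma nsq_ge0 v : 0 <= nsq v. Proof. by case: ip_inner. Qed.
Lemma ipDr u v w : ip w (u + v) = ip w u + ip w v.
Proof. by rewrite ipC ipDl !(ipC w). Qed.
Lemma ipZr a u v : ip u (a *: v) = a * ip u v.
Proof. by rewrite ipC ipZl (ipC u). Qed.
Lemma ipNl u v : ip (- u) v = - ip u v.
Proof. by rewrite -scaleN1r ipZl mulN1r. Qed.
Lemma ipNr u v : ip u (- v) = - ip u v.
Proof. by rewrite ipC ipNl ipC. Qed.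
Lemma ip0l v : ip 0 v = 0.
Proof. by rewrite -(scale0r 0) ipZl mul0r. Qed.

Lemma nsqD u v : nsq (u + v) = nsq u + 2 * ip u v + nsq v.
Proof. by rewrite !ipDl !ipDr (ipC v u); ring. Qed.
Lemma nsqN v : nsq (- v) = nsq v.
Proof. by rewrite ipNl ipNr opprK. Qed.
Lemma nsqZ a v : nsq (a *: v) = a ^+ 2 * nsq v.
Proof. by rewrite ipZl ipZr; ring. Qed.
Lemma nsqB u v : nsq (u - v) = nsq u - 2 * ip u v + nsq v.
Proof. by rewrite nsqD nsqN ipNr; ring. Qed.
Lemma nsq_distC u v : nsq (u - v) = nsq (v - u).
Proof. by rewrite -nsqN opprB. Qed.

Lemma ip_young c u v : 0 < c -> 2 * ip u v <= c * nsq u + c^-1 * nsq v.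
Proof.
move=> c0; have := nsq_ge0 (c *: u - v); rewrite nsqB nsqZ ipZl => h.
rewrite -(ler_pM2l c0) mulrDr mulVKf ?gt_eqF//; lra.
Qed.

Lemma nsqD_le c u v : 0 < c ->
  nsq (u + v) <= (1 + c) * nsq u + (1 + c^-1) * nsq v.
Proof. by move=> c0; have := ip_young u v c0; rewrite nsqD; lra. Qed.

Lemma nsq_shift_le c u v : 0 < c ->
  nsq u <= (1 + c) * nsq v + (1 + c^-1) * nsq (u - v).
Proof. by move=> c0; rewrite -[X in ip X X <= _](subrKC v u) nsqD_le. Qed.

(** Convexity of the square: (1 - b)(u + v) averages u and ((1 - b)/b) v with weights 1 - b and b.
    The resulting factor (1 - b)^2/b of |v|^2 is enlarged to 1/b. *)
Lemma nsqD_contract b u v : 0 < b -> b <= 1 ->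
  (1 - b) ^+ 2 * nsq (u + v) <= (1 - b) * nsq u + b^-1 * nsq v.
Proof.
move=> b0 b1; have := nsq_ge0 (b *: u - (1 - b) *: v).
rewrite nsqB !nsqZ ipZl ipZr => h.
rewrite -(ler_pM2l b0) mulrDr mulVKf ?gt_eqF// nsqD.
have h1 := mulr_ge0 (_ : 0 <= 1 - b) h; have := h1 ltac:(lra) => {h1} h1.
have h2 : 0 <= (b * (1 - b) + b) * nsq v.
  by apply: mulr_ge0 (nsq_ge0 v); nra.
nra.
Qed.

Section Projection.
Variable p : V -> V.
Hypothesis p_proj : orthogonal_projection ip p.

Lemma projB u v : p (u - v) = p u - p v.
Proof. by case: p_proj => pD pZ _ _; rewrite pD -scaleN1r pZ scaleN1r. Qed.

Lemma proj_orth u v : ip (u - p u) (p v) = 0.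
Proof.
case: (p_proj) => _ _ pK padj; rewrite -padj projB pK subrr.
exact: ip0l.
Qed.

(** Pythagoras: p u - v = p (u - v) lies in the range of p, to which u - p u is orthogonal. *)
Lemma nsq_proj_sub u v : p v = v ->
  nsq (u - v) = nsq (u - p u) + nsq (p u - v).
Proof.
move=> pv; have -> : u - v = (u - p u) + (p u - v) by rewrite addrA subrK.
rewrite [LHS]nsqD; suff -> : ip (u - p u) (p u - v) = 0 by ring.
by rewrite (_ : p u - v = p (u - v)) ?proj_orth// projB pv.
Qed.

Lemma nsq_proj u : nsq u = nsq (u - p u) + nsq (p u).
Proof.
by rewrite -[in LHS](subrK (p u) u) [LHS]nsqD proj_orth; ring.
Qed.

Lemma nsq_proj_le u : nsq (p u) <= nsq u.
Proof. by rewrite [leRHS]nsq_proj lerDr nsq_ge0. Qed.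

Lemma nsq_coproj_le u : nsq (u - p u) <= nsq u.
Proof. by rewrite [leRHS]nsq_proj lerDl nsq_ge0. Qed.

End Projection.

(** Cauchy-Schwarz on the telescoped increments. Allowing k above j lets one bound, with k the
    period length, serve every point of a period. *)
Lemma nsq_path_le (y : nat -> V) (s j k : nat) : (j <= k)%N ->
  nsq (y (s + j)%N - y s) <=
  k%:R * \sum_(i < k) nsq (y (s + i).+1 - y (s + i)%N).
Proof.
set D := fun i => nsq (y (s + i).+1 - y (s + i)%N).
have D0 i : 0 <= D i by apply: nsq_ge0.
have base : nsq (y (s + j)%N - y s) <= j%:R * \sum_(i < j) D i.
  elim: j => [|j IH]; first by rewrite addn0 subrr ip0l mul0r.
  have -> : y (s + j.+1)%N - y s = (y (s + j)%N - y s) + (y (s + j).+1 - y (s + j)%N).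
    by rewrite addnS [RHS]addrC addrA subrK.
  case: j IH => [_|j IH].
    by rewrite addn0 subrr add0r big_ord_recr big_ord0/= add0r mul1r /D addn0.
  have j0 : 0 < j.+1%:R :> R by rewrite ltr0n.
  have j'0 : 0 < j.+1%:R^-1 :> R by rewrite invr_gt0.
  (* With j increments already summed, the weight 1/j turns the factor j into (1 + 1/j) j = j + 1
     and gives the new increment 1 + j as well. *)
  apply: le_trans (nsqD_le _ _ j'0) _; rewrite invrK big_ord_recr/= -/(D j.+1).
  rewrite [in leRHS]mulrDr -[in leRHS]natr1 (addrC 1 j.+1%:R) lerD//.
  apply: le_trans (ler_wpM2l _ IH) _; first by rewrite addr_ge0// ltW.
  by rewrite mulrA mulrDl mul1r mulVf ?gt_eqF// addrC.
move=> jk; apply: (le_trans base); apply: ler_pM; rewrite ?ler0n ?ler_nat//.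
  by apply: sumr_ge0 => i _; apply: D0.
by rewrite -(subnKC jk) big_split_ord/= lerDl; apply: sumr_ge0 => i _; apply: nsq_ge0.
Qed.

(** * One step of projected momentum descent in an abstract space *)

Section ProjectedMomentum.
Variables (f : V -> R) (g : V -> V) (L b eta d : R) (tau : nat).
Variables (x m : nat -> V) (p : nat -> V -> V).

Hypothesis descent : forall u v, f (u + v) <= f u + ip (g u) v + L * nsq v.
Hypothesis lip : forall u v, nsq (g u - g v) <= L ^+ 2 * nsq (u - v).
Hypothesis p_proj : forall t, orthogonal_projection ip (p t).
Hypothesis p_keep : forall t, (t.+1 %% tau <> 0)%N -> p t.+1 =1 p t.
Hypothesis p_energy : forall t, (t %% tau = 0)%N ->
  d * nsq (g (x t)) <= nsq (p t (g (x t))).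
Hypothesis m0E : m 0%N = b *: p 0%N (g (x 0%N)).
Hypothesis mSE : forall t, m t.+1 = p t.+1 ((1 - b) *: m t + b *: g (x t.+1)).
Hypothesis xSE : forall t, x t.+1 = x t - eta *: m t.
Hypotheses (L0 : 0 < L) (b0 : 0 < b) (b1 : b <= 1) (eta0 : 0 < eta).
Hypotheses (d0 : 0 < d) (d1 : d <= 1).

Local Notation Gsq t := (nsq (g (x t))).
Local Notation D t := (nsq (x t.+1 - x t)).
Local Notation N t := (nsq (g (x t) - p t (g (x t)))).
Local Notation E t := (nsq (p t (g (x t)) - m t)).

Lemma momentum_in_range t : p t (m t) = m t.
Proof.
case: (p_proj t) => _ pZ pK _.
by case: t pZ pK => [|t] pZ pK; rewrite ?m0E ?mSE ?pZ pK.
Qed.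

(** Polarization: 2 <g, m> = |g|^2 + |m|^2 - |g - m|^2, where eta^2 |m|^2 is [D t] and |g - m|^2
    splits into [N t] and [E t]. *)
Lemma descent_step t :
  f (x t.+1) <= f (x t) - eta / 2 * Gsq t - ((2 * eta)^-1 - L) * D t
                + eta / 2 * (N t + E t).
Proof.
have -> : N t + E t = nsq (g (x t) - m t).
  by rewrite [RHS](nsq_proj_sub (p_proj t) _ (momentum_in_range t)).
have xE : x t.+1 = x t + (- eta) *: m t by rewrite xSE scaleNr.
have := descent (x t) ((- eta) *: m t); rewrite -xE ipZr nsqZ.
have -> : D t = eta ^+ 2 * nsq (m t).
  by rewrite xE addrC addKr nsqZ sqrrN.
rewrite nsqB sqrrN => /le_trans; apply; rewrite le_eqVlt; apply/orP; left.
by apply/eqP; field; rewrite gt_eqF.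
Qed.

Lemma grad_step t : nsq (g (x t.+1) - g (x t)) <= L ^+ 2 * D t.
Proof. exact: lip. Qed.

(** In all cases p' g' - m' = (1 - b) p' (g' - m). If p' = p, then p (g' - m) = (p g - m) + p (g' -
    g), so only E is contracted. If the projection changes, p' is dropped and |g - m|^2 = N + E
    brings in N. *)
Lemma error_step t :
  E t.+1 <= (1 - b) * E t + L ^+ 2 / b * D t
            + (if (t.+1 %% tau == 0)%N then N t else 0).
Proof.
have eE : p t.+1 (g (x t.+1)) - m t.+1 = (1 - b) *: p t.+1 (g (x t.+1) - m t).
  case: (p_proj t.+1) => pD pZ _ _.
  rewrite mSE (pD (_ *: _)) !pZ (projB (p_proj _)) scalerBr opprD addrCA addrC.
  by congr (_ - _); rewrite scalerBl scale1r addrC.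
have bD : b^-1 * nsq (g (x t.+1) - g (x t)) <= L ^+ 2 / b * D t.
  rewrite mulrAC [leRHS]mulrC; apply: ler_wpM2l (grad_step t).
  by rewrite invr_ge0 ltW.
rewrite eE nsqZ; case: eqP => [_|/p_keep pE].
  apply: le_trans (ler_wpM2l (sqr_ge0 _) (nsq_proj_le (p_proj _) _)) _.
  have -> : g (x t.+1) - m t = (g (x t) - m t) + (g (x t.+1) - g (x t)).
    by rewrite [RHS]addrC addrA subrK.
  apply: le_trans (nsqD_contract _ _ b0 b1) _.
  rewrite (nsq_proj_sub (p_proj t) _ (momentum_in_range t)).
  have := mulr_ge0 (ltW b0) (nsq_ge0 (g (x t) - p t (g (x t)))); lra.
have -> : p t.+1 (g (x t.+1) - m t)
    = (p t (g (x t)) - m t) + p t (g (x t.+1) - g (x t)).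
  rewrite pE !(projB (p_proj _)) momentum_in_range.
  by rewrite [RHS]addrC addrA subrK.
apply: le_trans (nsqD_contract _ _ b0 b1) _; rewrite addr0 lerD2l.
apply: le_trans bD; rewrite ler_wpM2l ?nsq_proj_le//.
by rewrite invr_ge0 ltW.
Qed.

Lemma error_init : E 0%N <= Gsq 0%N.
Proof.
apply: le_trans (nsq_proj_le (p_proj 0%N) _).
have -> : p 0%N (g (x 0%N)) - m 0%N = (1 - b) *: p 0%N (g (x 0%N)).
  by rewrite m0E scalerBl scale1r.
rewrite nsqZ ler_piMl ?nsq_ge0//.
by apply: exprn_ile1; move: b0 b1; lra.
Qed.

(** * Summation over one period *)

Hypothesis tau0 : (0 < tau)%N.
Local Notation S s := (\sum_(i < tau) D (s + i)%N).
Local Notation rho s := (L ^+ 2 * (tau%:R * S s)).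

Lemma projector_in_period k j : (j < tau)%N -> p (k * tau + j) =1 p (k * tau).
Proof.
elim: j => [|j IH] jtau; first by rewrite addn0.
move=> u; rewrite addnS p_keep; first exact/IH/ltnW.
by rewrite -addnS modnMDl modn_small.
Qed.

Lemma grad_in_period s j : (j < tau)%N ->
  nsq (g (x (s + j)%N) - g (x s)) <= rho s.
Proof.
move=> jtau; apply: le_trans (lip _ _) _.
by rewrite ler_wpM2l ?sqr_ge0// (nsq_path_le _ _ (ltnW jtau)).
Qed.

(** The energy hypothesis bounds the residual only at time s. It is carried to s + j by passing from
    v to u in the residual and back from u to v in the gradient; each passage costs the drift
    [rho s]. *)
Lemma residual_in_period k j (s := (k * tau)%N) : (j < tau)%N ->
  N (s + j)%N <= (1 - d / 2) * Gsq (s + j)%N + 10 / d * rho s.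
Proof.
have [d0' d1'] := (d0, d1).
move=> jtau; rewrite /s !(projector_in_period _ jtau) -/s.
have rho_le := grad_in_period s jtau.
set u := g (x s) in rho_le *; set v := g (x (s + j)%N) in rho_le *.
set q := p s; have q_proj : orthogonal_projection ip q by exact: p_proj.
(* Two Young steps of weight d/4 keep half of the gain: (1 + d/4)^2 (1 - d) <= 1 - d/2. *)
have a0 : 0 < d / 4 by lra.
have h1 := nsq_shift_le (v - q v) (u - q u) a0.
have h2 : nsq (v - q v - (u - q u)) <= rho s.
  have -> : v - q v - (u - q u) = (v - u) - q (v - u).
    by rewrite (projB q_proj) !opprB [q u - u]addrC addrACA [- q v + _]addrC.
  exact: le_trans (nsq_coproj_le q_proj _) rho_le.
have h3 : nsq (u - q u) <= (1 - d) * nsq u.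
  have := p_energy (modnMl k tau); rewrite -/s -/u -/q.
  by have := nsq_proj q_proj u; lra.
have h4 := nsq_shift_le u v a0; rewrite nsq_distC in h4.
have r0 : 0 <= rho s by apply: le_trans (nsq_ge0 _) rho_le.
have v0 := nsq_ge0 v.
set r := rho s in h2 rho_le r0 *.
have aE : 1 + (d / 4)^-1 = (d + 4) / d by field; rewrite gt_eqF.
rewrite aE in h1 h4.
have c0 : 0 <= (d + 4) / d by rewrite divr_ge0//; lra.
have h5 : nsq u <= (1 + d / 4) * nsq v + (d + 4) / d * r.
  by apply: le_trans h4 _; rewrite lerD2l ler_wpM2l.
have h6 : nsq (v - q v) <= (1 + d / 4) * ((1 - d) * nsq u) + (d + 4) / d * r.
  by apply: le_trans h1 _; apply: lerD; apply: ler_wpM2l => //; lra.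
have k0 : 0 <= (1 + d / 4) * (1 - d) by rewrite mulr_ge0//; lra.
apply: le_trans h6 _; rewrite mulrA.
apply: le_trans (lerD (ler_wpM2l k0 h5) (lexx _)) _.
rewrite mulrDr -addrA; apply: lerD.
  by rewrite mulrA ler_wpM2r//; nra.
rewrite -[X in _ + X]mul1r -mulrDl mulrA ler_wpM2r// ler_pdivlMr//.
by rewrite mulrA divfK ?gt_eqF//; nra.
Qed.

(** Averaged over j, this charges the two terms that occur once per period to 1/tau of the sum of
    squared gradients. The constants come from N <= |g|^2 at the last time and two Young steps of
    weight 1. *)
Lemma anchor_in_period k j (s := (k * tau)%N) : (j < tau)%N ->
  Gsq s + N (s + tau.-1)%N <= 6 * Gsq (s + j)%N + 8 * rho s.
Proof.
move=> jtau; have ltau : (tau.-1 < tau)%N by rewrite prednK.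
have h1 := nsq_coproj_le (p_proj (s + tau.-1)%N) (g (x (s + tau.-1)%N)).
have h2 := nsq_shift_le (g (x (s + tau.-1)%N)) (g (x s)) ltr01.
have h3 := nsq_shift_le (g (x s)) (g (x (s + j)%N)) ltr01.
rewrite nsq_distC in h3; have r1 := grad_in_period s jtau.
have r2 := grad_in_period s ltau; rewrite invr1 in h2 h3.
set r := rho s in r1 r2 *; lra.
Qed.

Lemma descent_sum s k :
  f (x (s + k)%N) <= f (x s) - eta / 2 * (\sum_(j < k) Gsq (s + j)%N)
    - ((2 * eta)^-1 - L) * (\sum_(j < k) D (s + j)%N)
    + eta / 2 * (\sum_(j < k) N (s + j)%N + \sum_(j < k) E (s + j)%N).
Proof.
elim: k => [|k IH]; first by rewrite !big_ord0 addn0; lra.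
rewrite addnS !big_ord_recr/=; have := descent_step (s + k); lra.
Qed.

Lemma error_sum_partial k j (s := (k * tau)%N) : (j < tau)%N ->
  E (s + j)%N + b * (\sum_(i < j) E (s + i)%N)
    <= E s + L ^+ 2 / b * (\sum_(i < j) D (s + i)%N).
Proof.
elim: j => [|j IH] jtau; first by rewrite !big_ord0 addn0; lra.
have := IH (ltnW jtau); rewrite !big_ord_recr/=.
have := error_step (s + j); rewrite -addnS modnMDl modn_small//= addnS; lra.
Qed.

(** Only the last step, into time s + tau, can change the projection, so a single N appears. *)
Lemma error_sum k (s := (k * tau)%N) :
  E (s + tau)%N + b * (\sum_(i < tau) E (s + i)%N)
    <= E s + L ^+ 2 / b * S s + N (s + tau.-1)%N.
Proof.
have sumS (F : nat -> R) : \sum_(i < tau) F i = \sum_(i < tau.-1) F i + F tau.-1 :> R.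
  by rewrite -[in LHS](prednK tau0) big_ord_recr.
rewrite (sumS (fun i => E (s + i)%N)) (sumS (fun i => D (s + i)%N)).
have := @error_sum_partial k tau.-1; rewrite -/s prednK// => /(_ (leqnn _)).
have := error_step (s + tau.-1); rewrite -addnS prednK// modnMDl modnn eqxx; lra.
Qed.

Hypothesis tau_ge : 64 <= tau%:R * (3 * b * d).
Hypothesis eta_L : 4 * (L * eta) <= 1.
Hypothesis eta_b : 80 * (L * eta) ^+ 2 <= 3 * d * b ^+ 2.
Hypothesis eta_tau : 80 * (L * eta) ^+ 2 * tau%:R ^+ 2 <= 3 * d.

(** The weight eta/(2 b) makes b times the sum of E in [error_sum] cancel eta/2 times that sum in
    [descent_sum]. The extra [Gsq s] on the left will absorb the initial error. *)
Lemma potential_period k (s := (k * tau)%N) :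
  f (x (s + tau)%N) + eta / (2 * b) * E (s + tau)%N + eta / (2 * b) * Gsq s
    + eta * d / 16 * (\sum_(i < tau) Gsq (s + i)%N)
  <= f (x s) + eta / (2 * b) * E s.
Proof.
have t0 : 0 < tau%:R :> R by rewrite ltr0n.
have constS (a : R) : \sum_(i < tau) a = a * tau%:R.
  by rewrite sumr_const card_ord mulr_natr.
have := descent_sum s tau; have /= := @error_sum k; rewrite -/s.
have : \sum_(i < tau) N (s + i)%N <=
    (1 - d / 2) * (\sum_(i < tau) Gsq (s + i)%N) + 10 / d * rho s * tau%:R.
  rewrite [X in X + _]mulr_sumr -constS -big_split/=; apply: ler_sum => i _.
  exact: residual_in_period.
have : tau%:R * (Gsq s + N (s + tau.-1)%N) <=
    6 * (\sum_(i < tau) Gsq (s + i)%N) + 8 * rho s * tau%:R.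
  rewrite [leLHS]mulrC [X in _ <= X + _]mulr_sumr -!constS -big_split/=.
  apply: ler_sum => i _.
  exact: anchor_in_period.
have S0 : 0 <= S s by apply: sumr_ge0 => i _; apply: nsq_ge0.
have Gsum0 : 0 <= \sum_(i < tau) Gsq (s + i)%N.
  by apply: sumr_ge0 => i _; apply: nsq_ge0.
move: (\sum_(i < tau) Gsq _) Gsum0 (S s) S0 => SG SG0 SD SD0.
move: (\sum_(i < tau) N _) (\sum_(i < tau) E _) => SN SE.
move: (N _) (E (s + tau)%N) (E s) (Gsq s) => Nl E1 E0 W.
move: (f (x (s + tau)%N)) (f (x s)) => f1 f0.
move: tau%:R t0 tau_ge eta_tau => T T0 hT hetaT hA hN hE hD.
move: eta_L eta_b b0 d0 d1 eta0 L0 => heL heb b_gt0 d_gt0 d_le1 e0 L_gt0.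
set c := eta / (2 * b); set w := L ^+ 2 * T ^+ 2; set y := 6 * SG + 8 * (w * SD).
have w0 : 0 <= w by rewrite mulr_ge0 ?sqr_ge0.
have y0 : 0 <= y by apply: addr_ge0; apply: mulr_ge0 => //; apply: mulr_ge0.
have c0 : 0 < c by rewrite divr_gt0// mulr_gt0.
(* The lower bound on tau says 1/(b T) <= 3 d/64; it multiplies the averaged anchor bound. *)
have hc : c * (W + Nl) <= eta / 2 * (3 * d / 64) * y.
  have : c / T <= eta / 2 * (3 * d / 64).
    rewrite ler_pdivrMr// /c ler_pdivrMr ?mulr_gt0//.
    rewrite -subr_ge0.
    have -> : eta / 2 * (3 * d / 64) * T * (2 * b) - eta
        = eta * ((T * (3 * b * d)) - 64) / 64 by field.
    by rewrite divr_ge0// mulr_ge0 ?subr_ge0// ltW.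
  move=> /(ler_wpM2r y0); apply: le_trans.
  rewrite -(mulrA c) ler_pM2l// mulrC ler_pdivlMr// mulrC.
  by apply: le_trans hA _; rewrite /y /w; lra.
have hE' : c * E1 + eta / 2 * SE <= c * E0 + c * (L ^+ 2 / b) * SD + c * Nl.
  have := ler_wpM2l (ltW c0) hE.
  have -> : c * (E1 + b * SE) = c * E1 + eta / 2 * SE.
    by rewrite /c; field; rewrite gt_eqF.
  by move=> /le_trans; apply; lra.
have hN' : eta / 2 * SN <= eta / 2 * ((1 - d / 2) * SG + 10 / d * w * SD).
  apply: ler_wpM2l; first by rewrite ltW// divr_gt0.
  by apply: le_trans hN _; rewrite /w; lra.
(* All drift terms fit into the descent budget: after scaling by 2 eta the right side is 1 - 2 L eta
   >= 1/2, while the left is below 1/2. *)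
have hS : c * (L ^+ 2 / b) + eta / 2 * (10 / d * w) + eta / 2 * (3 * d / 64) * (8 * w)
    <= (2 * eta)^-1 - L.
  have e20 : 0 < 2 * eta by rewrite mulr_gt0.
  rewrite -(ler_pM2l e20) mulrBr mulfV ?gt_eqF//.
  have -> : 2 * eta * (c * (L ^+ 2 / b) + eta / 2 * (10 / d * w) +
        eta / 2 * (3 * d / 64) * (8 * w))
      = (L * eta) ^+ 2 / b ^+ 2 + 10 * ((L * eta) ^+ 2 * T ^+ 2 / d)
        + 3 / 8 * d * ((L * eta) ^+ 2 * T ^+ 2).
    by rewrite /c /w; field; rewrite !gt_eqF.
  have h1 : (L * eta) ^+ 2 / b ^+ 2 <= 3 / 80 * d.
    by rewrite ler_pdivrMr ?exprn_gt0//; lra.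
  have h2 : (L * eta) ^+ 2 * T ^+ 2 / d <= 3 / 80 by rewrite ler_pdivrMr//; lra.
  have h3 : d * ((L * eta) ^+ 2 * T ^+ 2) <= 3 / 80 * d.
    have := @ler_wpM2l _ _ (ltW d_gt0) _ _ hetaT; nra.
  lra.
have hSD := ler_wpM2r SD0 hS.
have hSG : 0 <= eta * d * SG by rewrite !mulr_ge0// ltW.
(* Of the gain eta d/4 on the gradient sum, the anchor terms use 9 eta d/64; the remaining 7/64
   exceeds 1/16. *)
rewrite /y in hc; lra.
Qed.

Lemma sum_grad_le k : (0 < k)%N ->
  eta * d / 16 * (\sum_(t < k * tau) Gsq t) <= f (x 0%N) - f (x (k * tau)%N).
Proof.
have c0 : 0 < eta / (2 * b) by rewrite divr_gt0// mulr_gt0.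
(* The invariant retains [Gsq 0] from the first period only, which pays for [E 0] through
   [error_init]; hence the induction starts at k = 1. *)
move=> k0; suff : f (x (k * tau)%N) + eta / (2 * b) * E (k * tau)%N
    + eta / (2 * b) * Gsq 0%N + eta * d / 16 * (\sum_(t < k * tau) Gsq t)
    <= f (x 0%N) + eta / (2 * b) * E 0%N.
  have := ler_wpM2l (ltW c0) error_init.
  have := mulr_ge0 (ltW c0) (nsq_ge0 (p (k * tau) (g (x (k * tau)%N)) - m (k * tau))).
  lra.
case: k k0 => // k _; elim: k => [|k IH].
  by have /= := potential_period 0; rewrite mul0n mul1n add0n.
have /= := potential_period k.+1; rewrite [(k.+2 * tau)%N]mulSnr big_split_ord/=.
have := mulr_ge0 (ltW c0) (nsq_ge0 (g (x (k.+1 * tau)%N))); lra.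
Qed.

End ProjectedMomentum.
End InnerProduct.

(** * Frobenius inner product and the energy of leading singular directions *)

Section Frobenius.
Variable R : realType.

Definition frob (p q : nat) (A B : 'M[R]_(p, q)) : R := \tr (A *m B^T).

Lemma frobE p q (A B : 'M[R]_(p, q)) :
  frob A B = \sum_(i < p) \sum_(j < q) A i j * B i j.
Proof.
apply: eq_bigr => i _; rewrite mxE; apply: eq_bigr => j _.
by rewrite mxE.
Qed.

Lemma frobC p q (A B : 'M[R]_(p, q)) : frob A B = frob B A.
Proof. by rewrite /frob -mxtrace_tr trmx_mul trmxK. Qed.

Lemma frobDl p q (A B C : 'M[R]_(p, q)) : frob (A + B) C = frob A C + frob B C.
Proof. by rewrite /frob mulmxDl mxtraceD. Qed.

Lemma frobZl p q a (A B : 'M[R]_(p, q)) : frob (a *: A) B = a * frob A B.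
Proof. by rewrite /frob -scalemxAl mxtraceZ. Qed.

Lemma frob_ge0 p q (A : 'M[R]_(p, q)) : 0 <= frob A A.
Proof. by rewrite frobE; do 2!apply: sumr_ge0 => ? _; rewrite -expr2 sqr_ge0. Qed.

Lemma frob_tr p q (A B : 'M[R]_(p, q)) : frob A^T B^T = frob A B.
Proof. by rewrite /frob trmxK mxtrace_mulC -/(frob B A) frobC. Qed.

Lemma frob_mulr p q s (A : 'M[R]_(p, s)) (C : 'M[R]_(s, q)) (B : 'M[R]_(p, q)) :
  frob (A *m C) B = frob A (B *m C^T).
Proof. by rewrite /frob trmx_mul trmxK mulmxA. Qed.

Lemma frob_mull p q s (A : 'M[R]_(s, q)) (C : 'M[R]_(p, s)) (B : 'M[R]_(p, q)) :
  frob (C *m A) B = frob A (C^T *m B).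
Proof. by rewrite -frob_tr trmx_mul frob_mulr -trmx_mul frob_tr. Qed.

Lemma is_svd_tr p q (A : 'M[R]_(p, q)) U S V :
  is_svd A U S V -> is_svd A^T V S^T U.
Proof.
case=> UU VV -> [S0 Sge] Sdecr; split => //.
- by rewrite !trmx_mul trmxK mulmxA.
- by split=> i j ij; rewrite mxE; [apply: S0 => /esym|apply: Sge].
- by move=> i i' j j' ij ij' ii'; rewrite !mxE; apply: Sdecr; rewrite -?ij -?ij'.
Qed.

(** After cancelling the common part, both sides are sums over pairs of a leading index i and a
    trailing index j, compared termwise by s j <= s i. *)
Lemma sum_leading_ge (r k : nat) (s : 'I_(r + k) -> R) :
  (forall i j : 'I_(r + k), (i <= j)%N -> s j <= s i) ->
  r%:R * (\sum_i s i) <= (r + k)%:R * (\sum_(i < r) s (lshift k i)).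
Proof.
move=> sdecr; rewrite big_split_ord/= natrD mulrDr mulrDl lerD2l.
have constS q (a : R) : a *+ q = \sum_(i < q) a by rewrite sumr_const card_ord.
rewrite !mulr_natl !constS [leLHS]exchange_big/=.
apply: ler_sum => i _; apply: ler_sum => j _; apply: sdecr.
by rewrite /= ltnW// (leq_trans (ltn_ord _) (leq_addr _ _)).
Qed.

Lemma svd_leading_cols p q r (A : 'M[R]_(p, q)) U S V (P : 'M[R]_(p, r)) :
  (r <= p)%N -> is_svd A U S V -> leading_cols U P -> P^T *m P = 1%:M.
Proof.
move=> rp [UU _ _ _ _] UP; apply/matrixP => i j.
have := congr1 (fun M : 'M[R]_p => M (widen_ord rp i) (widen_ord rp j)) UU.
rewrite !mxE => <-; apply: eq_bigr => l _; rewrite !mxE.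
by rewrite (UP l i (widen_ord rp i))// (UP l j (widen_ord rp j)).
Qed.

(** Orthogonal invariance reduces both norms to sums of squared singular values: P^T A is the top r
    rows of S times V^T. As p <= q, every row of S has a diagonal entry. *)
Lemma svd_leading_energy p q r (A : 'M[R]_(p, q)) U S V (P : 'M[R]_(p, r)) :
  (r <= p)%N -> (p <= q)%N -> is_svd A U S V -> leading_cols U P ->
  r%:R * frob A A <= p%:R * frob (P *m P^T *m A) (P *m P^T *m A).
Proof.
move=> rp pq svdA UP; have PP := svd_leading_cols rp svdA UP.
have -> : frob (P *m P^T *m A) (P *m P^T *m A) = frob (P^T *m A) (P^T *m A).
  by rewrite -mulmxA frob_mull mulmxA PP mul1mx.
have [k pE] : exists k, p = (r + k)%N by exists (p - r)%N; rewrite subnKC.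
subst p; case: svdA => UU VV AE [S0 Sge] Sdecr.
have -> : P^T *m A = usubmx S *m V^T.
  have -> : P = lsubmx U by apply/matrixP => i j; rewrite mxE (UP i j (lshift k j)).
  rewrite trmx_lsub mul_usub_mx AE !mulmxA UU mul1mx.
  by rewrite mul_usub_mx.
rewrite frob_mulr trmxK -mulmxA VV mulmx1.
have -> : frob A A = frob S S.
  by rewrite AE frob_mulr trmxK -mulmxA VV mulmx1 frob_mull mulmxA UU mul1mx.
have SE (i : 'I_(r + k)) : \sum_j S i j * S i j = S i (widen_ord pq i) ^+ 2.
  rewrite (bigD1 (widen_ord pq i))//= big1 ?addr0// => j ji.
  by rewrite S0 ?mul0r// => ij; move/eqP: ji; apply; apply/val_inj.
rewrite !frobE; under [in leRHS]eq_bigr do under eq_bigr do rewrite !mxE.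
apply: sum_leading_ge => i j ij; rewrite !SE lerXn2r ?nnegrE ?Sge//.
exact: Sdecr.
Qed.

End Frobenius.

(** * The parameter space as an inner product space, and the GaLore projection on it *)

Section ParamsModule.
Variables (R : realType) (NL : nat) (m n : 'I_NL -> nat).
Local Notation T := (params R m n).

HB.instance Definition _ := gen_eqMixin T.
HB.instance Definition _ := gen_choiceMixin T.

Let pzero : T := fun l => 0.
Let popp (x : T) : T := fun l => - x l.

Lemma params_ext (x y : T) : (forall l, x l = y l) -> x = y.
Proof. exact: functional_extensionality_dep. Qed.

Fact paddA : associative (@padd R NL m n).
Proof. by move=> x y z; apply: params_ext => l; apply: addrA. Qed.
Fact paddC : commutative (@padd R NL m n).
Proof. by move=> x y; apply: params_ext => l; apply: addrC. Qed.
Fact padd0 : left_id pzero (@padd R NL m n).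
Proof. by move=> x; apply: params_ext => l; apply: add0r. Qed.
Fact paddN : left_inverse pzero popp (@padd R NL m n).
Proof. by move=> x; apply: params_ext => l; apply: addNr. Qed.

HB.instance Definition _ := GRing.isZmodule.Build T paddA paddC padd0 paddN.

Fact pscaleA a b (x : T) : pscale a (pscale b x) = pscale (a * b) x.
Proof. by apply: params_ext => l; apply: scalerA. Qed.
Fact pscale1 : left_id 1 (@pscale R NL m n).
Proof. by move=> x; apply: params_ext => l; apply: scale1r. Qed.
Fact pscaleDr : right_distributive (@pscale R NL m n) +%R.
Proof. by move=> a x y; apply: params_ext => l; apply: scalerDr. Qed.
Fact pscaleDl (x : T) : {morph (@pscale R NL m n)^~ x : a b / a + b}.
Proof. by move=> a b; apply: params_ext => l; apply: scalerDl. Qed.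

HB.instance Definition _ :=
  GRing.Zmodule_isLmodule.Build R T pscaleA pscale1 pscaleDr pscaleDl.

Lemma params_addE (u v : T) l : (u + v) l = u l + v l.
Proof. by []. Qed.

Lemma params_scaleE a (u : T) l : (a *: u) l = a *: u l.
Proof. by []. Qed.

Lemma pinnerE (x y : T) : pinner x y = \sum_l frob (x l) (y l).
Proof. by apply: eq_bigr => l _; rewrite frobE. Qed.

Lemma pinner_inner : inner_product (@pinner R NL m n).
Proof.
split=> [u v|u v w|a u v|v]; rewrite !pinnerE.
- by apply: eq_bigr => l _; apply: frobC.
- by rewrite -big_split/=; apply: eq_bigr => l _; apply: frobDl.
- by rewrite mulr_sumr; apply: eq_bigr => l _; apply: frobZl.
- by apply: sumr_ge0 => l _; apply: frob_ge0.
Qed.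

Lemma lipschitz_grad_sq (G : T -> T) (L : R) (u v : T) :
  0 < L -> lipschitz_grad G L ->
  pinner (G u - G v) (G u - G v) <= L ^+ 2 * pinner (u - v) (u - v).
Proof.
move=> L0 /(_ u v); rewrite /pnorm -!/(_ - _) => h.
have nn (w : T) : 0 <= pnormsq w by apply: (nsq_ge0 pinner_inner).
rewrite -[leLHS](sqr_sqrtr (nn _)) -[X in _ * X](sqr_sqrtr (nn _)) -exprMn.
by rewrite lerXn2r ?nnegrE ?sqrtr_ge0// mulr_ge0 ?sqrtr_ge0// ltW.
Qed.

(** [is_gradient] differentiates only at parameter 0, so the base point is moved to x + h v, where
    the difference quotients coincide. *)
Lemma is_derive_line (f : T -> R) (G : T -> T) (x v : T) (h : R) :
  is_gradient f G ->
  is_derive h (1 : R) (fun k : R => f (x + k *: v)) (pinner (G (x + h *: v)) v).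
Proof.
move=> /(_ (x + h *: v) v) fG.
have E : (fun k : R => k^-1 *:
      (((fun k : R => f (padd (x + h *: v) (pscale k v))) \o shift 0) (k *: 1)
       - f (padd (x + h *: v) (pscale 0 v)))) =
    (fun k : R => k^-1 *:
      (((fun k : R => f (x + k *: v)) \o shift h) (k *: 1) - f (x + h *: v))).
  apply: funext => k /=; congr (_ *: (f _ - f _)).
    rewrite -[padd _ _]/(_ + (_ *: v)) -addrA -scalerDl addr0.
    by rewrite [(h + _)%R]addrC.
  by rewrite -[padd _ _]/(_ + (_ *: v)) scale0r addr0.
case: fG => fd fv; split.
  by move: fd; rewrite /derivable E.
by move: fv; rewrite /derive E.
Qed.

(* The mean value theorem loses the factor 1/2 of the usual descent lemma;
   the step-size conditions leave room for that. *)
Lemma descent_lemma (f : T -> R) (G : T -> T) (L : R) (x v : T) :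
  0 < L -> is_gradient f G -> lipschitz_grad G L ->
  f (x + v) <= f x + pinner (G x) v + L * pinner v v.
Proof.
move=> L0 fG GL; pose phi (k : R) := f (x + k *: v).
have dphi k : is_derive k (1 : R) phi (pinner (G (x + k *: v)) v).
  exact: is_derive_line.
have cphi : {within `[0, 1], continuous phi}.
  apply: continuous_subspaceT => k; apply: differentiable_continuous.
  by apply/derivable1_diffP; case: (dphi k).
have [c /itvP c01] := MVT ltr01 (fun k _ => dphi k) cphi.
rewrite /phi scale1r scale0r addr0 subr0 mulr1 => E.
have -> : f (x + v) = f x + pinner (G x) v + pinner (G (x + c *: v) - G x) v.
  rewrite (ipDl pinner_inner) (ipNl pinner_inner) -E; ring.
rewrite lerD2l; have v0 := nsq_ge0 pinner_inner v.
have iL0 : 0 < L^-1 by rewrite invr_gt0.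
have := lipschitz_grad_sq (x + c *: v) x L0 GL.
rewrite {3 4}[x + _]addrC addrK (nsqZ pinner_inner).
move: (G (x + c *: v) - G x) => u h2.
(* Weight 1/L balances the two terms: |u|^2 <= L^2 |v|^2 makes each at most L |v|^2. *)
have := ip_young pinner_inner u v iL0; rewrite invrK.
have : L^-1 * pinner u u <= L * pinner v v.
  rewrite mulrC ler_pdivrMr//; apply: le_trans h2 _.
  rewrite [leRHS]mulrAC -expr2 ler_wpM2l ?sqr_ge0// ler_piMl// exprn_ile1//.
    by rewrite (ltW _)// c01.
  by rewrite (ltW _)// c01.
lra.
Qed.

Variable r : 'I_NL -> nat.

(** Acts at full size, so that momenta expressed in different low-rank bases live in one space. *)
Definition galore_proj (P : forall l, 'M[R]_(m l, r l))
    (Q : forall l, 'M[R]_(n l, r l)) (y : T) : T :=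
  fun l => if (m l <= n l)%N then P l *m (P l)^T *m y l
           else y l *m (Q l *m (Q l)^T).

Lemma galore_proj_orthogonal P Q :
  (forall l, (P l)^T *m P l = 1%:M) -> (forall l, (Q l)^T *m Q l = 1%:M) ->
  orthogonal_projection (@pinner R NL m n) (galore_proj P Q).
Proof.
move=> PP QQ; split=> [u v|a u|u|u v].
- apply: params_ext => l; rewrite params_addE /galore_proj params_addE.
  case: ifP => _; first exact: mulmxDr.
  exact: mulmxDl.
- apply: params_ext => l; rewrite params_scaleE /galore_proj params_scaleE.
  case: ifP => _; first exact/esym/scalemxAr.
  exact/esym/scalemxAl.
- apply: params_ext => l; rewrite /galore_proj/=; case: (m l <= n l)%N.
    by rewrite !mulmxA -(mulmxA (P l) (P l)^T (P l)) PP mulmx1.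
  by rewrite -!mulmxA (mulmxA (Q l)^T) QQ mul1mx.
- rewrite !pinnerE; apply: eq_bigr => l _; rewrite /galore_proj; case: ifP => _.
    by rewrite frob_mull trmx_mul trmxK.
  by rewrite frob_mulr trmx_mul trmxK.
Qed.

Lemma delta_min_le l : delta_min R m n r <= delta R m n r l.
Proof. exact: bigmin_le_cond. Qed.

Lemma galore_proj_energy P Q (y : T) :
  (forall l, (r l < minn (m l) (n l))%N) ->
  (forall l, exists U S V, is_svd (y l) U S V /\
     leading_cols U (P l) /\ leading_cols V (Q l)) ->
  delta_min R m n r * pinner y y
    <= pinner (galore_proj P Q y) (galore_proj P Q y).
Proof.
move=> rmn svdy; rewrite !pinnerE mulr_sumr; apply: ler_sum => l _.
apply: le_trans (ler_wpM2r (frob_ge0 _) (delta_min_le l)) _.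
have [U [S [V [svdl [UP VQ]]]]] := svdy l.
have := rmn l; rewrite leq_min => /andP[rm rn].
have min0 : 0 < (minn (m l) (n l))%:R :> R.
  by rewrite ltr0n (leq_ltn_trans _ (rmn l)).
rewrite /delta mulrAC ler_pdivrMr// [leRHS]mulrC /galore_proj.
have [mn|nm] := leqP (m l) (n l).
  exact: svd_leading_energy (ltnW rm) mn svdl UP.
(* A tall block is handled by transposition, which exchanges the roles of U and V. *)
have := svd_leading_energy (ltnW rn) (ltnW nm) (is_svd_tr svdl) VQ.
by rewrite -[Q l *m _]trmxK trmx_mul trmxK -trmx_mul !frob_tr trmx_mul trmxK.
Qed.

End ParamsModule.

(** A negative b is excluded because [Num.sqrt] is 0 there, while a > 0. *)
Lemma le_sqrt_sqr (R : realType) (a b : R) :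
  0 < a -> a <= Num.sqrt b -> a ^+ 2 <= b.
Proof.
move=> a0 ab; have b0 : 0 <= b.
  by rewrite leNgt; apply/negP => /ltW/ler0_sqrtr E; move: ab; rewrite E leNgt a0.
by rewrite -[leRHS]sqr_sqrtr// lerXn2r ?nnegrE ?sqrtr_ge0// ltW.
Qed.

(** * GaLore as an instance of projected momentum descent *)

Theorem theoremB2 (R : realType) (NL : nat) (m n r : 'I_NL -> nat)
    (f : params R m n -> R) (G : params R m n -> params R m n) (L : R)
    (beta1 eta : R) (tau : nat)
    (x : nat -> params R m n)
    (P : nat -> forall l : 'I_NL, 'M[R]_(m l, r l))
    (Q : nat -> forall l : 'I_NL, 'M[R]_(n l, r l))
    (ML : nat -> forall l : 'I_NL, 'M[R]_(r l, n l))
    (MR : nat -> forall l : 'I_NL, 'M[R]_(m l, r l)) :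
  (* f differentiable with gradient G *)
  is_gradient f G ->
  (* Assumption 1 *)
  (exists c : R, forall y, c <= f y) ->
  (* Assumption 2 *)
  0 < L -> lipschitz_grad G L ->
  (* ranks *)
  (forall l, (r l < minn (m l) (n l))%N) ->
  (* hyperparameters *)
  0 < beta1 -> beta1 <= 1 ->
  64 <= tau%:R * (3 * beta1 * delta_min R m n r) ->
  0 < eta ->
  eta <= 1 / (4 * L) ->
  eta <= Num.sqrt (3 * delta_min R m n r * beta1 ^+ 2 / (80 * L ^+ 2)) ->
  eta <= Num.sqrt (3 * delta_min R m n r / (80 * tau%:R ^+ 2 * L ^+ 2)) ->
  eta <= Num.sqrt (3 * beta1 / (16 * tau%:R * L ^+ 2)) ->
  (* projections: SVD of the current gradient every tau steps, otherwise kept *)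
  (forall t l, (t %% tau = 0)%N ->
     exists U S V, is_svd (G (x t) l) U S V /\
       leading_cols U (P t l) /\ leading_cols V (Q t l)) ->
  (forall t l, (t.+1 %% tau <> 0)%N -> P t.+1 l = P t l /\ Q t.+1 l = Q t l) ->
  (* momentum with momentum projection, M^(-1) = 0 *)
  (forall l, ML 0 l = beta1 *: ((P 0 l)^T *m G (x 0) l) /\
             MR 0 l = beta1 *: (G (x 0) l *m Q 0 l)) ->
  (forall t l,
     ML t.+1 l = (1 - beta1) *: ((P t.+1 l)^T *m P t l *m ML t l)
                 + beta1 *: ((P t.+1 l)^T *m G (x t.+1) l) /\
     MR t.+1 l = (1 - beta1) *: (MR t l *m (Q t l)^T *m Q t.+1 l)
                 + beta1 *: (G (x t.+1) l *m Q t.+1 l)) ->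
  (* parameter update *)
  (forall t l, x t.+1 l = x t l - eta *:
      (if (m l <= n l)%N then P t l *m ML t l else MR t l *m (Q t l)^T)) ->
  forall K : nat, (1 <= K)%N ->
    (K * tau)%:R^-1 * \sum_(t < K * tau) pnormsq (G (x t))
      <= 16 * (f (x 0) - inf (range f)) / (delta_min R m n r * eta * (K * tau)%:R).
Proof.
move=> fG [fmin fmin_le] L0 GL rmn b0 b1 hT eta0 eta_L eta_b eta_tau _.
move=> svdP keepP M0 MS xS K K0.
set d := delta_min R m n r in hT eta_b eta_tau *.
have T0 : 0 < tau%:R :> R.
  rewrite lt_neqAle ler0n andbT; apply/eqP => T0.
  by move: hT; rewrite -T0 mul0r; lra.
have d0 : 0 < d.
  have bT : 0 < tau%:R * (3 * beta1) by rewrite !mulr_gt0.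
  by rewrite -(pmulr_rgt0 _ bT) -mulrA; apply: lt_le_trans hT.
have d1 : d <= 1 by exact: bigmin_le_id.
(* Orthonormality comes from the SVD at refresh times and is inherited in between. *)
have PQ t l : (P t l)^T *m P t l = 1%:M /\ (Q t l)^T *m Q t l = 1%:M.
  have := rmn l; rewrite leq_min => /andP[/ltnW rm /ltnW rn].
  have base s : (s %% tau = 0)%N ->
      (P s l)^T *m P s l = 1%:M /\ (Q s l)^T *m Q s l = 1%:M.
    move=> /(svdP s l)[U [S [V [svdG [UP VQ]]]]].
    by split; [apply: svd_leading_cols svdG UP|
               apply: svd_leading_cols (is_svd_tr svdG) VQ].
  elim: t => [|t IH]; first by apply: base; rewrite mod0n.
  by have [/base//|/eqP/(keepP t l)[-> ->]] := eqVneq (t.+1 %% tau)%N 0%N.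
pose p t := galore_proj (P t) (Q t).
pose M t : params R m n := fun l =>
  if (m l <= n l)%N then P t l *m ML t l else MR t l *m (Q t l)^T.
have p_proj t : orthogonal_projection (@pinner R NL m n) (p t).
  by apply: galore_proj_orthogonal => l; case: (PQ t l).
have p_keep t : (t.+1 %% tau <> 0)%N -> p t.+1 =1 p t.
  move=> /keepP kPQ y; apply: params_ext => l; rewrite /p /galore_proj.
  by case: (kPQ l) => -> ->.
have p_energy t : (t %% tau = 0)%N ->
    d * pinner (G (x t)) (G (x t)) <= pinner (p t (G (x t))) (p t (G (x t))).
  by move=> t0; apply: galore_proj_energy => // l; apply: svdP.
have M0E : M 0%N = beta1 *: p 0%N (G (x 0%N)).
  apply: params_ext => l; rewrite params_scaleE /M /p /galore_proj.
  case: (M0 l) => -> ->; case: ifP => _.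
    by rewrite -scalemxAr mulmxA.
  by rewrite -scalemxAl mulmxA.
(* The factor P_t in the momentum projection P_{t+1}^T P_t is exactly the lift of the old momentum;
   lifting the new one by P_{t+1} completes the projector. The right-sided case is symmetric. *)
have MSE t : M t.+1 = p t.+1 ((1 - beta1) *: M t + beta1 *: G (x t.+1)).
  apply: params_ext => l; rewrite /M /p /galore_proj params_addE !params_scaleE/=.
  case: (MS t l) => -> ->; case: (m l <= n l)%N.
    by rewrite !mulmxDr -!scalemxAr !mulmxA.
  by rewrite !mulmxDl -!scalemxAl !mulmxA.
have xSE t : x t.+1 = x t - eta *: M t.
  by apply: params_ext => l; rewrite xS.
have := @sum_grad_le R (params R m n) _ (@pinner_inner R NL m n) f G L beta1 eta
  d tau x M p (fun u v => descent_lemma u v L0 fG GL)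
  (fun u v => lipschitz_grad_sq u v L0 GL) p_proj p_keep p_energy M0E MSE xSE
  L0 b0 b1 eta0 d0 d1.
rewrite -(ltr0n R) => /(_ T0 hT).
have -> : (4 * (L * eta) <= 1) by move: eta_L; rewrite ler_pdivlMr ?mulr_gt0//; lra.
have L2 : 0 < L ^+ 2 by rewrite exprn_gt0.
have -> : (80 * (L * eta) ^+ 2 <= 3 * d * beta1 ^+ 2).
  have := le_sqrt_sqr eta0 eta_b; rewrite ler_pdivlMr ?mulr_gt0//.
  by rewrite exprMn; lra.
have -> : (80 * (L * eta) ^+ 2 * tau%:R ^+ 2 <= 3 * d).
  have := le_sqrt_sqr eta0 eta_tau; rewrite ler_pdivlMr ?mulr_gt0 ?exprn_gt0//.
  by rewrite exprMn; lra.
move=> /(_ isT isT isT K K0) sum_le.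
(* Boundedness below makes [inf] a genuine lower bound of the range. *)
have inf_le : inf (range f) <= f (x (K * tau)%N).
  apply: ge_inf; last by exists (x (K * tau)%N).
  by exists fmin => _ [y _ <-].
have KT0 : 0 < (K * tau)%:R :> R by rewrite natrM mulr_gt0// ltr0n.
rewrite mulrC ler_pdivrMr// invfM mulrA mulfVK ?gt_eqF//.
rewrite ler_pdivlMr ?mulr_gt0//.
have : eta * d / 16 * (\sum_(t < K * tau) pnormsq (G (x t)))
    <= f (x 0%N) - inf (range f) by apply: le_trans sum_le _; rewrite lerD2l lerN2.
lra.
Qed.
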